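(* Let $\mathcal{C}$ be an abelian category, let $\mathcal{X},\mathcal{T}\subseteq\mathcal{C}$ be classes of objects, and let $\alpha\subseteq\mathcal{T}^{\perp}\cap\mathcal{X}^{\perp}$ be a relative cogenerator in $\mathcal{X}$. Then, for every $n\geq 1$, the class $\mathcal{X}\cap\mathcal{T}^{\perp}$ is closed by $n$-quotients in $\mathcal{X}$ if, and only if, $\mathrm{pd}_{\mathcal{X}}(\mathcal{T})\leq n$.
   Context: $\mathrm{Ext}^i_{\mathcal{C}}$ denotes the $i$-th Yoneda extension bifunctor of $\mathcal{C}$; no enough projectives or injectives are assumed. For a class $\mathcal{Z}\subseteq\mathcal{C}$, $\mathcal{Z}^{\perp}:=\{C\in\mathcal{C} : \mathrm{Ext}^i_{\mathcal{C}}(Z,C)=0 \text{ for all } Z\in\mathcal{Z},\ i\geq 1\}$. A class $\omega$ is a relative cogenerator in $\mathcal{X}$ if $\omega\subseteq\mathcal{X}$ and every $X\in\mathcal{X}$ admits an exact sequence $0\to X\to W\to X'\to 0$ in $\mathcal{C}$ with $W\in\omega$ and $X'\in\mathcal{X}$. For $C\in\mathcal{C}$, $\mathrm{pd}_{\mathcal{X}}(C):=\min\{n\in\mathbb{N} : \mathrm{Ext}^k_{\mathcal{C}}(C,X)=0\ \forall X\in\mathcal{X},\ \forall k>n\}$ (with $0\in\mathbb{N}$, and $\infty$ if no such $n$ exists), and $\mathrm{pd}_{\mathcal{X}}(\mathcal{T}):=\sup\{\mathrm{pd}_{\mathcal{X}}(T) : T\in\mathcal{T}\}$. For $\mathcal{Y}\subseteq\mathcal{X}$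 and $n\geq1$, $\mathcal{Y}$ is closed by $n$-quotients in $\mathcal{X}$ if for any exact sequence $0\to A\to Y_n\xrightarrow{\varphi_n}Y_{n-1}\to\cdots\to Y_1\xrightarrow{\varphi_1}B\to0$ in $\mathcal{C}$ with $Y_i\in\mathcal{Y}$ and $\mathrm{Ker}(\varphi_i)\in\mathcal{X}$ for all $1\le i\le n$, and $B\in\mathcal{X}$, one has $B\in\mathcal{Y}$. *)

(* Defs.v *)
From mathcomp Require Import all_boot all_order all_algebra.
From mathcomp Require Import boolp classical_sets.
From Stdlib Require Import Relations.Relation_Operators.

Set Implicit Arguments.
Unset Strict Implicit.
Unset Printing Implicit Defensive.

Import GRing.Theory.
Local Open Scope ring_scope.
Local Open Scope classical_set_scope.

(* [comp g f] is g after f. *)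
Record preadditive := Preadditive {
  obj :> Type;
  hom : obj -> obj -> zmodType;
  idm : forall A, hom A A;
  comp : forall A B D, hom B D -> hom A B -> hom A D;
  compA : forall A B D E (h : hom D E) (g : hom B D) (f : hom A B),
    comp h (comp g f) = comp (comp h g) f;
  comp1m : forall A B (f : hom A B), comp (idm B) f = f;
  compm1 : forall A B (f : hom A B), comp f (idm A) = f;
  compDl : forall A B D (g g' : hom B D) (f : hom A B),
    comp (g + g') f = comp g f + comp g' f;
  compDr : forall A B D (g : hom B D) (f f' : hom A B),
    comp g (f + f') = comp g f + comp g f'
}.

Arguments hom {p} A B.
Arguments idm {p} A.
Arguments comp {p A B D} g f.
Notation "g \c f" := (comp g f) (at level 40, left associativity) : ring_scope.

Section Preadditive.
Variable C : preadditive.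

Definition monic (A B : C) (f : hom A B) : Prop :=
  forall (Z : C) (g h : hom Z A), f \c g = f \c h -> g = h.

Definition epic (A B : C) (f : hom A B) : Prop :=
  forall (Z : C) (g h : hom B Z), g \c f = h \c f -> g = h.

Definition is_kernel (K A B : C) (f : hom A B) (k : hom K A) : Prop :=
  f \c k = 0 /\
  forall (Z : C) (g : hom Z A), f \c g = 0 -> exists! h : hom Z K, k \c h = g.

Definition is_cokernel (A B Q : C) (f : hom A B) (q : hom B Q) : Prop :=
  q \c f = 0 /\
  forall (Z : C) (g : hom B Z), g \c f = 0 -> exists! h : hom Q Z, h \c q = g.

Definition is_zero_object (O : C) : Prop :=
  forall A : C, (exists! f : hom A O, True) /\ (exists! f : hom O A, True).

Definition is_biproduct (A B S : C) (i1 : hom A S) (i2 : hom B S)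
    (p1 : hom S A) (p2 : hom S B) : Prop :=
  [/\ p1 \c i1 = idm A, p2 \c i2 = idm B, p2 \c i1 = 0, p1 \c i2 = 0
    & i1 \c p1 + i2 \c p2 = idm S].

(* Im f is the kernel of a cokernel of f. *)
Definition is_image (I A B : C) (f : hom A B) (m : hom I B) : Prop :=
  exists (Q : C) (q : hom B Q), is_cokernel f q /\ is_kernel q m.

Definition exact (A B D : C) (f : hom A B) (g : hom B D) : Prop :=
  exists (I : C) (m : hom I B), is_image f m /\ is_kernel g m.

Definition short_exact (A B D : C) (f : hom A B) (g : hom B D) : Prop :=
  [/\ monic f, exact f g & epic g].

End Preadditive.

Record abelian := Abelian {
  ab_cat :> preadditive;
  ab_zero : exists O : ab_cat, is_zero_object O;
  ab_biproduct : forall A B : ab_cat,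
    exists S (i1 : hom A S) (i2 : hom B S) (p1 : hom S A) (p2 : hom S B),
      is_biproduct i1 i2 p1 p2;
  ab_kernel : forall (A B : ab_cat) (f : hom A B),
    exists K (k : hom K A), is_kernel f k;
  ab_cokernel : forall (A B : ab_cat) (f : hom A B),
    exists Q (q : hom B Q), is_cokernel f q;
  ab_monic_normal : forall (A B : ab_cat) (f : hom A B), monic f ->
    exists D (g : hom B D), is_kernel g f;
  ab_epic_conormal : forall (A B : ab_cat) (f : hom A B), epic f ->
    exists D (g : hom D A), is_cokernel g f
}.

Section Yoneda.
Variable C : abelian.

(* The sequence A, E 0, E 1, E 2, ... *)
Definition prev (A : C) (E : nat -> C) (i : nat) : C :=
  if i is j.+1 then E j else A.

(* For n >= 1, an exact sequence
     0 -> B -> E_n -> E_(n-1) -> ... -> E_1 -> A -> 0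
   with E_(i+1) = mid i and phi_(i+1) = diff i : E_(i+1) -> E_i, E_0 = A.
   Only the values mid i and diff i with i < n are meaningful. *)
Record extension (n : nat) (A B : C) := Extension {
  mid : nat -> C;
  diff : forall i, hom (mid i) (prev A mid i);
  incl : hom B (mid n.-1);
  diff_epic : epic (diff 0);
  diff_exact : forall i, (i.+1 < n)%N -> exact (diff i.+1) (diff i);
  incl_exact : exact incl (diff n.-1);
  incl_monic : monic incl
}.

Definition prev_map (A : C) (E F : nat -> C) (f : forall i, hom (E i) (F i))
    (i : nat) : hom (prev A E i) (prev A F i) :=
  if i is j.+1 then f j else idm A.

(* There is a morphism of exact sequences E -> F that is the identity on both
   ends. *)
Definition extension_morphism (n : nat) (A B : C) (E F : extension n A B) :
    Prop :=
  exists f : forall i, hom (mid E i) (mid F i),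
    (forall i, (i < n)%N -> diff F i \c f i = prev_map A f i \c diff E i) /\
    f n.-1 \c incl E = incl F.

(* Yoneda equivalence; Ext^n(A, B), n >= 1, is the group of its classes. *)
Definition extension_equiv (n : nat) (A B : C) :
    extension n A B -> extension n A B -> Prop :=
  clos_refl_sym_trans _ (@extension_morphism n A B).

Lemma comp0m (A B D : C) (f : hom A B) : (0 : hom B D) \c f = 0.
Proof. by apply: (addrI (0 \c f)); rewrite -compDl !addr0. Qed.

Lemma compm0 (A B D : C) (g : hom B D) : g \c (0 : hom A B) = 0.
Proof. by apply: (addrI (g \c 0)); rewrite -compDr !addr0. Qed.

Lemma exact0_monic (A B D : C) (g : hom B D) :
  monic g -> exact (0 : hom A B) g.
Proof.
have [O HO] := ab_zero C; move=> mg.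
have H0 (Z : C) (h k : hom Z O) : h = k.
  have [[f [_ fU]] _] := HO Z.
  by rewrite -(fU h I) (fU k I).
exists O, 0; split; last first.
  split; first by rewrite compm0.
  move=> Z k; rewrite -(compm0 Z g) => /mg ->.
  by exists 0; split=> [|? _]; rewrite ?compm0.
exists B, (idm B); split; split; rewrite ?compm0 //.
  by move=> Z k _; exists k; split=> [|h]; rewrite compm1.
move=> Z k; rewrite comp1m => ->.
by exists 0; split=> [|? _]; rewrite ?compm0.
Qed.

Lemma exact_epic0 (A B D : C) (f : hom A B) :
  epic f -> exact f (0 : hom B D).
Proof.
have [O HO] := ab_zero C; move=> ef.
have H0 (Z : C) (h k : hom O Z) : h = k.
  have [_ [l [_ lU]]] := HO Z.
  by rewrite -(lU h I) (lU k I).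
have kid (Z : C) : is_kernel (0 : hom B Z) (idm B).
  split; first by rewrite comp0m.
  by move=> Y k _; exists k; split=> [|h]; rewrite comp1m.
exists B, (idm B); split=> //; exists O, 0; split=> //.
split; first by rewrite comp0m.
move=> Z k; rewrite -(comp0m Z f) => /ef ->.
by exists 0; split=> [|? _]; rewrite ?comp0m.
Qed.

(* There always is an extension, hence the group Ext^n(A, B) vanishes as soon as
   any two extensions are equivalent. *)
Lemma extension_inhabited (n : nat) (A B : C) :
  (1 <= n)%N -> inhabited (extension n A B).
Proof.
case: n => [//|[|m]] _.
  have [S [i1 [i2 [p1 [p2 [e1 e2 e21 e12 eS]]]]]] := ab_biproduct A B.
  pose d i : hom S (prev A (fun=> S) i) := if i is j.+1 then 0 else p1.
  have mi2 : monic i2.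
    move=> Z g h /(congr1 (comp p2)).
    by rewrite !compA e2 !comp1m.
  have ep1 : epic p1.
    move=> Z g h /(congr1 (fun k => k \c i1)).
    by rewrite -!compA e1 !compm1.
  have ki2 : is_kernel p1 i2.
    split=> // Z g g0; exists (p2 \c g); split=> [|h <-].
      rewrite -[RHS]comp1m -eS compDl compA.
      by rewrite -[i1 \c p1 \c g]compA g0 compm0 add0r.
    by rewrite compA e2 comp1m.
  constructor; apply: (@Extension 1 A B (fun=> S) d i2) => //.
  exists B, i2; split=> //; exists A, p1; split=> //.
  split=> // Z g g0; exists (g \c i1); split=> [|h <-].
    rewrite -[RHS]compm1 -eS compDr !compA.
    by rewrite g0 comp0m addr0.
  by rewrite -compA e1 compm1.
have [O HO] := ab_zero C.
have H0 (Z : C) (h k : hom Z O) : h = k.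
  have [[f [_ fU]] _] := HO Z.
  by rewrite -(fU h I) (fU k I).
pose E i : C := if i is j.+1 then if j == m then B else O else A.
pose d i : hom (E i) (prev A E i) := if i is j.+1 then 0 else idm A.
have [u [mu eu]] : exists u : hom B (E m.+1), monic u /\ epic u.
  rewrite /E eqxx; exists (idm B).
  by split=> Z g h; rewrite ?comp1m ?compm1.
constructor; apply: (@Extension m.+2 A B E d u) => //.
- by move=> Z g h; rewrite !compm1.
- move=> [|i] lti; first by apply: exact0_monic => Z g h; rewrite !comp1m.
  have EO : E i.+1 = O.
    by rewrite /E; have /negPf -> : i != m by rewrite neq_ltn -2!ltnS lti.
  have mO (Y Y' : C) (g : hom Y Y') : Y = O -> monic g.
    by move=> YO Z h k _; move: h k; rewrite YO; apply: H0.
  by apply: exact0_monic; apply: mO.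
- exact: exact_epic0.
Qed.

(* Ext^n(A, B) = 0, i.e. this group has a single element; Ext^0 = Hom.  The
   classes may form a proper class, hence no type of elements is formed. *)
Definition Ext_zero (n : nat) (A B : C) : Prop :=
  if n is 0 then forall f : hom A B, f = 0
  else forall E F : extension n A B, extension_equiv E F.

Definition right_perp (Z : set C) : set C :=
  [set Y | forall A, Z A -> forall i, (1 <= i)%N -> Ext_zero i A Y].

Definition relative_cogenerator (W X : set C) : Prop :=
  W `<=` X /\
  forall A, X A -> exists (M A' : C) (f : hom A M) (g : hom M A'),
    [/\ W M, X A' & short_exact f g].

End Yoneda.

(* The naturals with infinity, which is None. *)
Definition enat := option nat.

Definition enat_le (x y : enat) : Prop :=
  match x, y with
  | _, None => True
  | None, Some _ => False
  | Some m, Some n => (m <= n)%N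
  end.

(* min P, and infinity if P is empty. *)
Definition enat_min (P : set nat) : enat :=
  match pselect (exists n, `[< P n >]) with
  | left exP => Some (ex_minn exP)
  | right _ => None
  end.

(* The supremum in the extended naturals; it is 0 for the empty set. *)
Definition enat_sup (S : set enat) : enat :=
  enat_min [set n | forall x, S x -> enat_le x (Some n)].

Section Dimension.
Variable C : abelian.

Definition pd (X : set C) (A : C) : enat :=
  enat_min [set n | forall B, X B -> forall k, (n < k)%N -> Ext_zero k A B].

Definition pd_class (X T : set C) : enat := enat_sup (pd X @` T).

(* Classes of objects need not be closed under isomorphism: "Ker(phi) in X"
   means that some kernel of phi belongs to X. *)
Definition closed_by_quotients (n : nat) (Y X : set C) : Prop :=
  forall (A B : C) (E : extension n B A),
    (forall i, (i < n)%N -> Y (mid E i)) ->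
    (forall i, (i < n)%N ->
       exists (K : C) (k : hom K (mid E i)), X K /\ is_kernel (diff E i) k) ->
    X B -> Y B.

End Dimension.

(* Main.v *)
(* Vanishing of Ext^{k+1}(T, K) and Ext^k(T, Y) forces that of Ext^k(T, B) for a
   short exact sequence K -> Y -> B, and vanishing of Ext^k(T, B) and
   Ext^{k+1}(T, Y) forces that of Ext^{k+1}(T, K).  Given this, one shifts along
   the cycles of 0 -> A -> Y_n -> ... -> Y_1 -> B -> 0 in one direction, and in
   the other along an n-step coresolution of M in X by objects of alpha, whose
   last term belongs to X and hence, by closure, to T^perp.

   Without projectives or injectives the shifting has to be extracted from a
   zigzag of morphisms of extensions.  The invariant is a predicate [Null E u],
   "the pullback of E along u is zero", defined by recursion on the length: u
   lifts through the last middle term, or some short exact sequence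
   W -> H -> P maps to the rightmost short exact sequence of E over u in such a
   way that the induced map on kernels is Null for the remaining sequence.  It
   is transported along morphisms of extensions in both directions, the backward
   one needing a homotopy in the induction, and unfolding it for a spliced
   sequence yields the lift required by the long exact sequence. *)
Require Import Defs.
From mathcomp Require Import all_boot all_order all_algebra.
From mathcomp Require Import boolp classical_sets.
From Stdlib Require Import Relations.Relation_Operators.

Import Defs GRing.Theory.
Local Open Scope ring_scope.
Local Open Scope classical_set_scope.

Section RelativeDimension.

Set Implicit Arguments.
Unset Strict Implicit.
Unset Printing Implicit Defensive.

Variable C : abelian.
Implicit Types A B D K P Q Z : C.

(** * Short exact sequences *)

Lemma compNl A B D (g : hom B D) (f : hom A B) : (- g) \c f = - (g \c f).
Proof. by apply: (addrI (g \c f)); rewrite -compDl !subrr comp0m. Qed.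

Lemma compNr A B D (g : hom B D) (f : hom A B) : g \c (- f) = - (g \c f).
Proof. by apply: (addrI (g \c f)); rewrite -compDr !subrr compm0. Qed.

Lemma compBl A B D (g g' : hom B D) (f : hom A B) :
  (g - g') \c f = g \c f - g' \c f.
Proof. by rewrite compDl compNl. Qed.

Lemma compBr A B D (g : hom B D) (f f' : hom A B) :
  g \c (f - f') = g \c f - g \c f'.
Proof. by rewrite compDr compNr. Qed.

Lemma monicP A B (f : hom A B) :
  monic f <-> forall Z (g : hom Z A), f \c g = 0 -> g = 0.
Proof.
split=> [mf Z g fg0 | f0 Z g h fgh]; first by apply: mf; rewrite compm0.
by apply/eqP; rewrite -subr_eq0; apply/eqP/f0; rewrite compBr fgh subrr.
Qed.

Lemma epicP A B (f : hom A B) :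
  epic f <-> forall Z (g : hom B Z), g \c f = 0 -> g = 0.
Proof.
split=> [ef Z g gf0 | f0 Z g h ghf]; first by apply: ef; rewrite comp0m.
by apply/eqP; rewrite -subr_eq0; apply/eqP/f0; rewrite compBl ghf subrr.
Qed.

Lemma monic_comp A B D (g : hom B D) (f : hom A B) :
  monic g -> monic f -> monic (g \c f).
Proof. by move=> mg mf Z h k; rewrite -!compA => /mg /mf. Qed.

Lemma epic_comp A B D (g : hom B D) (f : hom A B) :
  epic g -> epic f -> epic (g \c f).
Proof. by move=> eg ef Z h k; rewrite !compA => /ef /eg. Qed.

Lemma epic_idm A : epic (idm A).
Proof. by move=> Z g h; rewrite !compm1. Qed.

Lemma kernel_lift K A B (f : hom A B) (k : hom K A) : is_kernel f k ->
  forall Z (g : hom Z A), f \c g = 0 -> exists h, k \c h = g.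
Proof. by move=> [_ kU] Z g /kU [h [hE _]]; exists h. Qed.

Lemma kernel_monic K A B (f : hom A B) (k : hom K A) :
  is_kernel f k -> monic k.
Proof.
move=> [fk0 kU]; apply/monicP => Z g kg0.
have [|h [_ hU]] := kU Z 0; first by rewrite compm0.
by rewrite -(hU g kg0); apply: hU; rewrite compm0.
Qed.

Lemma kernel_intro K A B (f : hom A B) (k : hom K A) :
  f \c k = 0 -> monic k ->
  (forall Z (g : hom Z A), f \c g = 0 -> exists h, k \c h = g) ->
  is_kernel f k.
Proof.
move=> fk0 mk kP; split=> // Z g /kP [h hE].
by exists h; split=> // h'; rewrite -hE => /mk.
Qed.

Lemma cokernel_desc A B Q (f : hom A B) (q : hom B Q) : is_cokernel f q ->
  forall Z (g : hom B Z), g \c f = 0 -> exists h, h \c q = g.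
Proof. by move=> [_ qU] Z g /qU [h [hE _]]; exists h. Qed.

Lemma cokernel_epic A B Q (f : hom A B) (q : hom B Q) :
  is_cokernel f q -> epic q.
Proof.
move=> [qf0 qU]; apply/epicP => Z g gq0.
have [|h [_ hU]] := qU Z 0; first by rewrite comp0m.
by rewrite -(hU g gq0); apply: hU; rewrite comp0m.
Qed.

Lemma cokernel_intro A B Q (f : hom A B) (q : hom B Q) :
  q \c f = 0 -> epic q ->
  (forall Z (g : hom B Z), g \c f = 0 -> exists h, h \c q = g) ->
  is_cokernel f q.
Proof.
move=> qf0 eq qP; split=> // Z g /qP [h hE].
by exists h; split=> // h'; rewrite -hE => /eq.
Qed.

(** By conormality [f] is a cokernel of some [g], and [g] factors through [k]; hence whatever kills
    [k] kills [g]. *)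
Lemma epic_cokernel_of_kernel K A B (f : hom A B) (k : hom K A) :
  epic f -> is_kernel f k -> is_cokernel k f.
Proof.
move=> ef kf; have [D [g gf]] := ab_epic_conormal ef.
apply: cokernel_intro => //; first exact: kf.1.
move=> Z h hk0; apply: (cokernel_desc gf).
by have [g' <-] := kernel_lift kf gf.1; rewrite compA hk0 comp0m.
Qed.

Lemma monic_kernel_of_cokernel A B Q (f : hom A B) (q : hom B Q) :
  monic f -> is_cokernel f q -> is_kernel q f.
Proof.
move=> mf qf; have [D [g gf]] := ab_monic_normal mf.
apply: kernel_intro => //; first exact: qf.1.
move=> Z h qh0; apply: (kernel_lift gf).
by have [g' <-] := cokernel_desc qf gf.1; rewrite -compA qh0 compm0.
Qed.

Lemma kernel_comp_monic K A B D (g : hom A B) (m : hom B D) (k : hom K A) :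
  monic m -> is_kernel (m \c g) k <-> is_kernel g k.
Proof.
move=> mm; have eq0 Z (h : hom Z A) : m \c g \c h = 0 <-> g \c h = 0.
  by rewrite -compA; split=> [/(monicP m).1|->]; [apply | rewrite compm0].
by split=> -[/eq0 gk0 kU]; split=> // Z h /eq0 /kU.
Qed.

Lemma cokernel_comp_epic A B D Q (f : hom B D) (e : hom A B) (q : hom D Q) :
  epic e -> is_cokernel (f \c e) q <-> is_cokernel f q.
Proof.
move=> ee; have eq0 Z (h : hom D Z) : h \c (f \c e) = 0 <-> h \c f = 0.
  by rewrite compA; split=> [/(epicP e).1|->]; [apply | rewrite comp0m].
by split=> -[/eq0 gk0 kU]; split=> // Z h /eq0 /kU.
Qed.

Lemma monic_epic_inverse A B (f : hom A B) : monic f -> epic f ->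
  exists g : hom B A, f \c g = idm B.
Proof.
move=> mf /epicP ef; have [D [r rf]] := ab_monic_normal mf.
by apply: (kernel_lift rf); rewrite compm1; apply: ef; apply: rf.1.
Qed.

(* If h kills e, then k \c ker h is a smaller kernel through which f factors. *)
Lemma exact_factor K A B D (f : hom A B) (g : hom B D) (k : hom K B) :
  exact f g -> is_kernel g k -> exists2 e, f = k \c e & epic e.
Proof.
move=> [I [m [[Q [q [qf mq]]] mg]]] kg.
have [e' e'E] := kernel_lift mq qf.1.
have [e eE] : exists e, k \c e = f.
  by apply: (kernel_lift kg); rewrite -e'E compA mg.1 comp0m.
exists e => //; apply/epicP => Z h he0.
have [L [l lh]] := ab_kernel h.
have [s sE] := kernel_lift lh he0.
have ml := kernel_monic lh; have mk := kernel_monic kg.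
have [R [r rkl]] := ab_monic_normal (monic_comp mk ml).
have rf0 : r \c f = 0 by rewrite -eE -sE !compA -(compA r) rkl.1 comp0m.
have [r' r'E] := cokernel_desc qf rf0.
have [t tE] := kernel_lift mg kg.1.
have rk0 : r \c k = 0 by rewrite -tE -r'E compA -(compA r') mq.1 compm0 comp0m.
have [w wE] := kernel_lift rkl rk0.
have lw : l \c w = idm K by apply: mk; rewrite compA wE compm1.
by rewrite -(compm1 h) -lw compA lh.1 comp0m.
Qed.

Lemma exact_epic_kernel K A B D (e : hom A K) (k : hom K B) (g : hom B D) :
  epic e -> is_kernel g k -> exact (k \c e) g.
Proof.
move=> ee kg; exists K, k; split=> //.
have [Q [q qk]] := ab_cokernel k.
exists Q, q; split; first by apply/cokernel_comp_epic.
exact: monic_kernel_of_cokernel (kernel_monic kg) qk.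
Qed.

(** The epic part [e] of [f] over a kernel of [g] is monic because [f] is. It therefore has a right
    inverse, which turns lifts through that kernel into lifts through [f]. *)
Lemma exact_kernel A B D (f : hom A B) (g : hom B D) :
  monic f -> exact f g -> is_kernel g f.
Proof.
move=> mf fg; have [K [k kg]] := ab_kernel g.
have [e fE ee] := exact_factor fg kg.
have me : monic e by move=> Z u v uv; apply: mf; rewrite fE -!compA uv.
have [e' ee'] := monic_epic_inverse me ee.
apply: kernel_intro => //; first by rewrite fE compA kg.1 comp0m.
move=> Z h /(kernel_lift kg) [h' <-]; exists (e' \c h').
by rewrite fE -compA (compA e) ee' comp1m.
Qed.

Lemma kernel_exact A B D (f : hom A B) (g : hom B D) :
  is_kernel g f -> exact f g.
Proof.
by move=> fg; rewrite -(compm1 f); apply: exact_epic_kernel fg; apply: epic_idm.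
Qed.

Lemma exact_comp_monic A B D E (f : hom A B) (g : hom B D) (m : hom D E) :
  monic m -> exact f (m \c g) <-> exact f g.
Proof.
by move=> mm; split=> -[I [i [fi /kernel_comp_monic gi]]]; exists I, i; split=> //;
  apply: gi || apply/kernel_comp_monic.
Qed.

(** Both universal properties are stored, since the diagram chases below lift into the kernel as
    well as descend along the cokernel. *)
Record ses A B := Ses {
  smid : C;
  sincl : hom B smid;
  sproj : hom smid A;
  ses_ker : is_kernel sproj sincl;
  ses_coker : is_cokernel sincl sproj
}.

Lemma sincl_monic A B (s : ses A B) : monic (sincl s).
Proof. exact: kernel_monic (ses_ker s). Qed.

Lemma sproj_epic A B (s : ses A B) : epic (sproj s).
Proof. exact: cokernel_epic (ses_coker s). Qed.

Arguments sincl_monic {A B} s.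
Arguments sproj_epic {A B} s.

Definition ses_of_epic A B M (i : hom B M) (p : hom M A) (ep : epic p)
    (ip : is_kernel p i) : ses A B :=
  Ses ip (epic_cokernel_of_kernel ep ip).

Definition ses_of_monic A B M (i : hom B M) (p : hom M A) (mi : monic i)
    (pi : is_cokernel i p) : ses A B :=
  Ses (monic_kernel_of_cokernel mi pi) pi.

Lemma ses_of_short_exact A B M (f : hom B M) (g : hom M A) :
  short_exact f g -> exists s : ses A B, smid s = M.
Proof.
by move=> [mf fg eg]; exists (ses_of_epic eg (exact_kernel mf fg)).
Qed.

Definition sesmor A B A' B' (s : ses A B) (t : ses A' B') (a : hom A A')
    (b : hom B B') : Prop :=
  exists2 m : hom (smid s) (smid t),
    m \c sincl s = sincl t \c b & sproj t \c m = a \c sproj s.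

Lemma sesmor_id A B (s : ses A B) : sesmor s s (idm A) (idm B).
Proof. by exists (idm _); rewrite ?comp1m ?compm1. Qed.

Lemma sesmor_comp A B A' B' A'' B'' (s : ses A B) (t : ses A' B')
    (r : ses A'' B'') a b a' b' :
  sesmor s t a b -> sesmor t r a' b' -> sesmor s r (a' \c a) (b' \c b).
Proof.
move=> [m mi pm] [m' mi' pm']; exists (m' \c m).
  by rewrite -compA mi !compA mi'.
by rewrite compA pm' -!compA pm.
Qed.

(** * Pullbacks and pushouts of short exact sequences *)

Definition is_pullback P A B D (f : hom A D) (g : hom B D) (p : hom P A)
    (q : hom P B) : Prop :=
  [/\ f \c p = g \c q,
      (forall Z (x y : hom Z P), p \c x = p \c y -> q \c x = q \c y -> x = y)
    & forall Z (x : hom Z A) (y : hom Z B), f \c x = g \c y ->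
      exists2 h, p \c h = x & q \c h = y].

Lemma pullback_exists A B D (f : hom A D) (g : hom B D) :
  exists P (p : hom P A) (q : hom P B), is_pullback f g p q.
Proof.
have [S [i1 [i2 [p1 [p2 [e1 e2 e21 e12 eS]]]]]] := ab_biproduct A B.
have [P [k kP]] := ab_kernel (f \c p1 - g \c p2).
exists P, (p1 \c k), (p2 \c k); split.
- by apply/eqP; rewrite -subr_eq0 !compA -compBl kP.1.
- move=> Z x y; rewrite -!compA => x1 x2; apply: (kernel_monic kP).
  by rewrite -(comp1m (k \c x)) -(comp1m (k \c y)) -eS !compDl -!compA x1 x2.
move=> Z x y fxgy.
have p1xy : p1 \c (i1 \c x + i2 \c y) = x.
  by rewrite compDr !compA e1 e12 comp1m comp0m addr0.
have p2xy : p2 \c (i1 \c x + i2 \c y) = y.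
  by rewrite compDr !compA e2 e21 comp1m comp0m add0r.
have [|h hE] := kernel_lift kP (g := i1 \c x + i2 \c y).
  by rewrite compBl -!compA p1xy p2xy fxgy subrr.
by exists h; rewrite -compA hE.
Qed.

(** The difference [f \c p1 - g \c p2] is epic, hence the cokernel of its kernel. If [h] kills [q],
    then [h \c p2] factors through it by some [t]; restricting to the first summand gives
    [t \c f = 0], so [t = 0] and [h = 0]. *)
Lemma pullback_epic P A B D (f : hom A D) (g : hom B D) (p : hom P A)
    (q : hom P B) :
  is_pullback f g p q -> epic f -> epic q.
Proof.
move=> [sq _ pU] ef.
have [S [i1 [i2 [p1 [p2 [e1 e2 e21 e12 eS]]]]]] := ab_biproduct A B.
have ed : epic (f \c p1 - g \c p2).
  apply/epicP => Z h /(congr1 (comp^~ i1)); rewrite comp0m -compA.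
  by rewrite compBl -!compA e1 e21 compm1 compm0 subr0 => /(epicP f).1; apply.
have [K [k kd]] := ab_kernel (f \c p1 - g \c p2).
have dk := epic_cokernel_of_kernel ed kd.
have [h' hp hq] : exists2 h, p \c h = p1 \c k & q \c h = p2 \c k.
  by apply: pU; apply/eqP; rewrite -subr_eq0 !compA -compBl kd.1.
apply/epicP => Z h hq0.
have [|t tE] := cokernel_desc dk (g := h \c p2).
  by rewrite -compA -hq compA hq0 comp0m.
have t0 : t = 0.
  apply: (epicP f).1 => //; move/(congr1 (comp^~ i1)): tE.
  by rewrite -!compA compBl -!compA e1 e21 compm1 !compm0 subr0.
move/(congr1 (comp^~ i2)): tE.
by rewrite t0 !comp0m -compA e2 compm1.
Qed.

Lemma ses_pullback A B A' (s : ses A B) (a : hom A' A) :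
  exists s' : ses A' B, sesmor s' s a (idm B).
Proof.
have [P [p [q pq]]] := pullback_exists (sproj s) a.
have eq := pullback_epic pq (sproj_epic s).
have [sq pqI pqU] := pq.
have [|i pi qi] := pqU B (sincl s) 0.
  by rewrite compm0 (ses_ker s).1.
have iq : is_kernel q i.
  apply: kernel_intro => //.
    move=> Z x y /(congr1 (comp p)).
    by rewrite !compA pi => /(sincl_monic s).
  move=> Z x qx0.
  have [|y yE] := kernel_lift (ses_ker s) (g := p \c x).
    by rewrite compA sq -compA qx0 compm0.
  exists y; apply: pqI; first by rewrite compA pi.
  by rewrite compA qi comp0m qx0.
by exists (ses_of_epic eq iq), p; rewrite ?compm1.
Qed.

(** The lift is first built on the cover [q] of [P], where [e] is corrected by a map into [B] so as
    to match [x]. The corrected map kills the kernel of [q], so it descends to [P]. *)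
Lemma ses_pullback_lift A B A' (s : ses A B) (s' : ses A' B)
    (m : hom (smid s) (smid s')) a P (x : hom P (smid s')) (u : hom P A) :
  m \c sincl s = sincl s' -> sproj s' \c m = a \c sproj s ->
  sproj s' \c x = a \c u -> exists l, sproj s \c l = u.
Proof.
move=> mi pm xu; have [H [e [q pq]]] := pullback_exists (sproj s) u.
have eq := pullback_epic pq (sproj_epic s).
have [sq _ _] := pq.
have [|b bE] := kernel_lift (ses_ker s') (g := m \c e - x \c q).
  by rewrite compBr !compA pm xu -!compA sq subrr.
have mE : m \c (e - sincl s \c b) = x \c q.
  by rewrite compBr compA mi bE opprB addrC subrK.
have pE : sproj s \c (e - sincl s \c b) = u \c q.
  by rewrite compBr compA (ses_ker s).1 comp0m subr0.
have [K [k kq]] := ab_kernel q.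
have ek0 : (e - sincl s \c b) \c k = 0.
  have [|c cE] := kernel_lift (ses_ker s) (g := (e - sincl s \c b) \c k).
    by rewrite compA pE -compA kq.1 compm0.
  have : sincl s' \c c = 0 by rewrite -mi -compA cE compA mE -compA kq.1 compm0.
  by move/(monicP _).1: (sincl_monic s') => /[apply] c0; rewrite -cE c0 compm0.
have [l lE] := cokernel_desc (epic_cokernel_of_kernel eq kq) ek0.
by exists l; apply: eq; rewrite -compA lE.
Qed.

(** The pushout is the cokernel [q] of [d]. Since [sincl s] is monic, [d] is monic and thus a kernel
    of [q], which yields that the new inclusion [q \c i1] is monic. The last two clauses are the
    universal property. *)
Lemma ses_pushout A B B' (s : ses A B) (b : hom B B') :
  exists (s' : ses A B') (m : hom (smid s) (smid s')),
  [/\ m \c sincl s = sincl s' \c b, sproj s' \c m = sproj s,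
      (forall Z (x y : hom (smid s') Z),
         x \c sincl s' = y \c sincl s' -> x \c m = y \c m -> x = y)
    & forall Z (x : hom B' Z) (y : hom (smid s) Z), x \c b = y \c sincl s ->
      exists2 h, h \c sincl s' = x & h \c m = y].
Proof.
have [S [i1 [i2 [p1 [p2 [e1 e2 e21 e12 eS]]]]]] := ab_biproduct B' (smid s).
set d := i1 \c b - i2 \c sincl s.
have [Q [q qd]] := ab_cokernel d.
have sq : q \c i2 \c sincl s = q \c i1 \c b.
  by apply/esym/eqP; rewrite -subr_eq0 -!compA -compBr qd.1.
have qI Z (x y : hom Q Z) :
    x \c (q \c i1) = y \c (q \c i1) -> x \c (q \c i2) = y \c (q \c i2) -> x = y.
  rewrite !compA => x1 x2; apply: (cokernel_epic qd).
  by rewrite -(compm1 (x \c q)) -(compm1 (y \c q)) -eS !compDr !compA x1 x2.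
have qU Z (x : hom B' Z) (y : hom (smid s) Z) : x \c b = y \c sincl s ->
    exists2 h, h \c (q \c i1) = x & h \c (q \c i2) = y.
  move=> xy.
  have xyi1 : (x \c p1 + y \c p2) \c i1 = x.
    by rewrite compDl -!compA e1 e21 compm1 compm0 addr0.
  have xyi2 : (x \c p1 + y \c p2) \c i2 = y.
    by rewrite compDl -!compA e2 e12 compm1 compm0 add0r.
  have [|h hE] := cokernel_desc qd (g := x \c p1 + y \c p2).
    by rewrite compBr !compA xyi1 xyi2 xy subrr.
  by exists h; rewrite compA hE.
have md : monic d.
  apply/monicP => Z h /(congr1 (comp p2)).
  rewrite compm0 compA compBr !compA e21 e2 comp1m comp0m sub0r compNl.
  move/eqP; rewrite oppr_eq0 => /eqP.
  by move/(monicP _).1: (sincl_monic s); apply.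
have dq := monic_kernel_of_cokernel md qd.
have mi : monic (q \c i1).
  apply/monicP => Z h; rewrite -compA => /(kernel_lift dq) [c cE].
  have c0 : c = 0.
    move/(congr1 (comp p2)): cE.
    rewrite compA compBr !compA e21 e2 comp1m !comp0m sub0r compNl.
    move/eqP; rewrite oppr_eq0 => /eqP.
    by move/(monicP _).1: (sincl_monic s); apply.
  move/(congr1 (comp p1)): cE.
  by rewrite c0 !compm0 compA e1 comp1m.
have [|p pi pm] := qU A 0 (sproj s); first by rewrite comp0m (ses_ker s).1.
have ip : is_cokernel (q \c i1) p.
  apply: cokernel_intro => //.
    move=> Z x y /(congr1 (comp^~ (q \c i2))).
    by rewrite -!compA [p \c _]pm => /(sproj_epic s).
  move=> Z x xi0.
  have [|y yE] := cokernel_desc (ses_coker s) (g := x \c (q \c i2)).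
    by rewrite -compA sq compA xi0 comp0m.
  exists y; apply: qI; first by rewrite -compA pi compm0 xi0.
  by rewrite -compA pm.
by exists (ses_of_monic mi ip), (q \c i2).
Qed.

(** * Vanishing of Yoneda extension groups *)

(* Exact sequences with n + 1 middle terms, as a short exact sequence at the
   right-hand end A followed by a shorter sequence ending in its kernel. *)
Fixpoint ext (n : nat) (A B : C) : Type :=
  if n is m.+1 then {Z : C & (ses A Z * ext m Z B)%type} else ses A B.

Definition consx n A B Z (s : ses A Z) (E : ext n Z B) : ext n.+1 A B :=
  existT _ Z (s, E).

Fixpoint extmor (n : nat) (A B A' B' : C) :
    ext n A B -> ext n A' B' -> hom A A' -> hom B B' -> Prop :=
  match n with
  | 0 => fun E F a b => sesmor E F a b
  | m.+1 => fun E F a b => exists2 z : hom (projT1 E) (projT1 F),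
      sesmor (projT2 E).1 (projT2 F).1 a z &
      extmor (projT2 E).2 (projT2 F).2 z b
  end.

Lemma extmor_id n A B (E : ext n A B) : extmor E E (idm A) (idm B).
Proof.
elim: n A E => [|n IH] A E; first exact: sesmor_id.
by exists (idm _); [exact: sesmor_id | exact: IH].
Qed.

Lemma extmor_comp n A B A' B' A'' B'' (E : ext n A B) (F : ext n A' B')
    (G : ext n A'' B'') a b a' b' :
  extmor E F a b -> extmor F G a' b' -> extmor E G (a' \c a) (b' \c b).
Proof.
elim: n A A' A'' E F G a a' => [|n IH] A A' A'' E F G a a'.
  exact: sesmor_comp.
move=> [z sz Ez] [z' sz' Ez'].
by exists (z' \c z); [exact: sesmor_comp sz sz' | exact: IH Ez Ez'].
Qed.

Definition ext_equiv n A B : ext n A B -> ext n A B -> Prop :=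
  clos_refl_sym_trans _ (fun E F => extmor E F (idm A) (idm B)).

Definition ext_vanish n A B := forall E F : ext n A B, ext_equiv E F.

Lemma ext_pullback n A B A' (E : ext n A B) (a : hom A' A) :
  exists E' : ext n A' B, extmor E' E a (idm B).
Proof.
case: n E => [|n] E; first exact: ses_pullback.
case: E => Z [s E]; have [s' ss'] := ses_pullback s a.
by exists (consx s' E), (idm Z) => //; apply: extmor_id.
Qed.

(** Only the short exact sequence at the left-hand end is pushed out. The universal property later
    gives uniqueness up to equivalence. *)
Lemma ext_pushout n A B B' (E : ext n A B) (b : hom B B') :
  exists2 E' : ext n A B', extmor E E' (idm A) b &
    forall A'' B'' (F : ext n A'' B'') a (b' : hom B' B''),
      extmor E F a (b' \c b) -> extmor E' F a b'.
Proof.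
elim: n A E => [|n IH] A E.
  have [E' [m [mi pm mI mU]]] := ses_pushout E b.
  exists E'; first by exists m; rewrite ?comp1m.
  move=> A'' B'' F a b' [l li pl].
  have [|h hi hm] := mU _ (sincl F \c b') l; first by rewrite -compA li.
  exists h => //; apply: mI.
    by rewrite -!compA hi compA (ses_ker F).1 (ses_ker E').1 comp0m compm0.
  by rewrite -!compA hm pm.
case: E => Z [s E]; have [E' EE' E'U] := IH Z E.
exists (consx s E'); first by exists (idm Z) => //; apply: sesmor_id.
by move=> A'' B'' F a b' [z sz /E'U Ez]; exists z.
Qed.

(** Every target of a morphism out of [G] over [b] receives a morphism from the pushout of [G], so a
    zigzag can be pushed forward link by link. *)
Lemma ext_pushout_equiv n A B B' (E F : ext n A B) (E' F' : ext n A B')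
    (b : hom B B') :
  ext_equiv E F -> extmor E E' (idm A) b -> extmor F F' (idm A) b ->
  ext_equiv E' F'.
Proof.
have push1 (G : ext n A B) (G1 G2 : ext n A B') :
    extmor G G1 (idm A) b -> extmor G G2 (idm A) b -> ext_equiv G1 G2.
  have [G0 _ G0U] := ext_pushout G b.
  move=> GG1 GG2; apply: (@rst_trans _ _ _ G0); last first.
    by apply: rst_step; apply: G0U; rewrite comp1m.
  by apply: rst_sym; apply: rst_step; apply: G0U; rewrite comp1m.
move=> EF; elim: EF E' F' => {E F} [E F EF|E|E F _ IH|E F G _ IHE _ IHG] E' F'.
- move=> EE' /(extmor_comp EF); rewrite compm1 compm1.
  exact: push1 EE'.
- exact: push1.
- by move=> EE' FF'; apply: rst_sym; apply: IH.
have [G' GG' _] := ext_pushout F b.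
by move=> EE' FF'; apply: (@rst_trans _ _ _ G'); [apply: IHE|apply: IHG].
Qed.

(* Null E u expresses that the pullback of E along u represents 0. *)
Fixpoint Null (n : nat) (A B : C) :
    ext n A B -> forall P : C, hom P A -> Prop :=
  match n with
  | 0 => fun E P u => exists l : hom P (smid E), sproj E \c l = u
  | m.+1 => fun E P u => exists W (t : ses P W) (w : hom W (projT1 E)),
      sesmor t (projT2 E).1 u w /\ Null (projT2 E).2 w
  end.

Definition ext_proj n A B : ext n A B -> {M : C & hom M A} :=
  match n with
  | 0 => fun E => existT _ (smid E) (sproj E)
  | m.+1 => fun E => existT _ (smid (projT2 E).1) (sproj (projT2 E).1)
  end.

Lemma ext_proj_epic n A B (E : ext n A B) : epic (projT2 (ext_proj E)).
Proof. by case: n E => [|n] E /=; apply: sproj_epic. Qed.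

Lemma Null0 n A B (E : ext n A B) P : Null E (0 : hom P A).
Proof.
elim: n A P E => [|n IH] A P E /=; first by exists 0; rewrite compm0.
have [O OP] := ab_zero C.
have eqO Z (x y : hom Z O) : x = y.
  by have [[f [_ fU]] _] := OP Z; rewrite -(fU x I) (fU y I).
have k0 : is_kernel (idm P) (0 : hom O P).
  apply: kernel_intro; first by rewrite compm0.
    by move=> Z x y _; apply: eqO.
  by move=> Z g; rewrite comp1m => ->; exists 0; rewrite compm0.
exists O, (ses_of_epic (@epic_idm P) k0), 0; split; last exact: IH.
by exists 0; rewrite ?comp0m ?compm0.
Qed.

Lemma Null_comp n A B (E : ext n A B) P Q (u : hom P A) (v : hom Q P) :
  Null E u -> Null E (u \c v).
Proof.
case: n E => [|n] E /=; first by move=> [l <-]; exists (l \c v); rewrite compA.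
move=> [W [t [w [tE wE]]]]; have [t' tt'] := ses_pullback t v.
exists W, t', w; split=> //.
by rewrite -(compm1 w); apply: sesmor_comp tt' tE.
Qed.

(* The homotopy x makes the induction work: the two maps out of the kernel built
   at each stage agree in the kernel of F only up to such a homotopy. *)
Lemma Null_descent n A A' B (E : ext n A B) (F : ext n A' B) a P
    (u : hom P A) (v : hom P A') (x : hom P (projT1 (ext_proj F))) :
  extmor E F a (idm B) -> a \c u - v = projT2 (ext_proj F) \c x ->
  Null F v -> Null E u.
Proof.
elim: n A A' E F a P u v x => [|n IH] A A' E F a P u v x /=.
  move=> [m mi pm] auv [l lE].
  apply: (ses_pullback_lift (s' := F) (m := m) (x := x + l)).
  - by rewrite mi compm1.
  - exact: pm.
  - by rewrite compDr -auv lE subrK.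
case: E F x => [Z [s E]] [Z' [s' F]] /= x [z [m mi pm] EF] auv.
move=> [W [t [w [[h hi ph] Fw]]]].
(* On the cover [H2] of [smid t] there are two maps to [smid s'], one through [s] and one through
   [t] corrected by [x]. They agree in [A'], so they differ by a map [r] into [Z']. *)
have [H2 [e [q2 pq2]]] := pullback_exists (sproj s) (u \c sproj t).
have eq2 := pullback_epic pq2 (sproj_epic s).
have [sq2 _ _] := pq2.
have [|r rE] := kernel_lift (ses_ker s')
    (g := m \c e - (h + x \c sproj t) \c q2).
  rewrite compBr; have -> : sproj s' \c (m \c e) = a \c u \c sproj t \c q2.
    by rewrite compA pm -compA sq2 !compA.
  by rewrite compA compDr ph compA -auv compBl [v \c _ + _]addrC subrK subrr.
(* On the further cover [H3] the map [r] lifts to [y], which restricts to the homotopy of the next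
   stage. The kernel of the cover [q] of [P] provides the new short exact sequence. *)
have [H3 [y [q3 pq3]]] := pullback_exists (projT2 (ext_proj F)) r.
have eq3 := pullback_epic pq3 (@ext_proj_epic _ _ _ F).
have [sq3 _ _] := pq3.
pose q := sproj t \c q2 \c q3.
have eq : epic q by do !apply: epic_comp => //; exact: sproj_epic.
have [W' [j jq]] := ab_kernel q.
have [|w' w'E] := kernel_lift (ses_ker s) (g := e \c q3 \c j).
  by rewrite !compA sq2 -[RHS](compm0 W' u) -jq.1 /q !compA.
have [|i iE] := kernel_lift (ses_ker t) (g := q2 \c q3 \c j).
  by rewrite -[RHS]jq.1 /q !compA.
exists W', (ses_of_epic eq jq), w'; split.
  by exists (e \c q3); rewrite //= /q !compA sq2.
apply: (IH _ _ _ F z _ _ (w \c i) (y \c j) EF); last exact: Null_comp.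
apply: (sincl_monic s').
rewrite [projT2 _ \c _]compA sq3 -compA [RHS]compA rE compBr !compA -mi -hi.
rewrite -(compA m) w'E -(compA h) iE !compBl !compDl -!compA.
have -> : sproj t \c (q2 \c (q3 \c j)) = 0 by rewrite -jq.1 /q !compA.
by rewrite compm0 addr0.
Qed.

Lemma Null_extmor n A A' B B' (E : ext n A B) (F : ext n A' B') a b P
    (u : hom P A) :
  extmor E F a b -> Null E u -> Null F (a \c u).
Proof.
elim: n A A' E F a P u => [|n IH] A A' E F a P u /=.
  by move=> [m _ pm] [l <-]; exists (m \c l); rewrite !compA pm.
move=> [z sz EF] [W [t [w [tE wE]]]].
exists W, t, (z \c w); split; last exact: IH EF wE.
exact: sesmor_comp tE sz.
Qed.

(** Being [Null] along the identity is invariant under equivalence. Vanishing makes [E] equivalent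
    to its pullback [E0] along 0, and for [E0] the property descends from [Null0]. *)
Lemma ext_vanish_Null n A B (E : ext n A B) :
  ext_vanish n A B -> Null E (idm A).
Proof.
have desc (F G : ext n A B) : extmor F G (idm A) (idm B) ->
    Null G (idm A) <-> Null F (idm A).
  move=> FG; split; last by rewrite -{2}(compm1 (idm A)); apply: Null_extmor FG.
  apply: (Null_descent (x := 0) FG).
  by rewrite compm0 compm1 subrr.
have eqv (F G : ext n A B) : ext_equiv F G -> Null F (idm A) <-> Null G (idm A).
  elim=> {F G} [F G /desc|F|F G _|F G L _ ? _ ?] //; last by tauto.
  - by tauto.
  - by tauto.
move=> AB0; have [E0 E0E] := ext_pullback E (0 : hom A A).
apply/(eqv _ _ (AB0 E E0)).
apply: (Null_descent (x := 0) E0E); last exact: Null0.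
by rewrite comp0m compm0 subrr.
Qed.

(** * Splicing at the left-hand end and dimension shifting *)

Fixpoint splice (n : nat) (A B K : C) : ext n A B -> ses B K -> ext n.+1 A K :=
  match n with
  | 0 => fun E s => @consx 0 A K B E s
  | m.+1 => fun E s => consx (projT2 E).1 (splice (projT2 E).2 s)
  end.

Lemma unsplice n A K (E : ext n.+1 A K) :
  exists B (E' : ext n A B) (s : ses B K), E = splice E' s.
Proof.
elim: n A E => [|n IH] A [Z [s E]]; first by exists Z, s, E.
by have [B [E' [t ->]]] := IH Z E; exists B, (consx s E'), t.
Qed.

Lemma extmor_splice n A B K A' B' K' (E : ext n A B) (s : ses B K)
    (F : ext n A' B') (t : ses B' K') a b k :
  extmor E F a b -> sesmor s t b k -> extmor (splice E s) (splice F t) a k.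
Proof.
move=> EF st; elim: n A A' E F a EF => [|n IH] A A' E F a /=; first by exists b.
by move=> [z sz /IH]; exists z.
Qed.

Lemma ext_equiv_splice n A B K (E F : ext n A B) (s : ses B K) :
  ext_equiv E F -> ext_equiv (splice E s) (splice F s).
Proof.
elim=> {E F} [E F EF|E|E F _|E F G _ + _].
- by apply: rst_step; apply: extmor_splice EF _; apply: sesmor_id.
- exact: rst_refl.
- exact: rst_sym.
- exact: rst_trans.
Qed.

(** The sequences [t] chosen at the successive stages of [Null] assemble to [G], and the lift at the
    last stage is [y]. So the pullback of [E] along [u] comes from [smid s]. *)
Lemma Null_splice n A B K (E : ext n A B) (s : ses B K) P (u : hom P A) :
  Null (splice E s) u ->
  exists Z (G : ext n P Z) (y : hom Z (smid s)), extmor G E u (sproj s \c y).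
Proof.
elim: n A E P u => [|n IH] A E P u /= [W [t [w [tE]]]].
  by move=> [y yE]; exists W, t, y; rewrite yE.
by move=> /IH [Z [G [y GE]]]; exists Z, (consx t G), y, w.
Qed.

(** This is exactness at the middle of Ext(A, Y) -> Ext(A, B) -> Ext(A, K), where Y is [smid s] and
    the second map, splicing with [s], raises the degree by one: each [E] is a pushout along
    [sproj s]. *)
Lemma ext_vanish_quotient n A B K (s : ses B K) :
  ext_vanish n.+1 A K -> ext_vanish n A (smid s) -> ext_vanish n A B.
Proof.
move=> AK0 AY0.
have from_mid (E : ext n A B) : exists G : ext n A (smid s),
    forall E' : ext n A B, extmor G E' (idm A) (sproj s) -> ext_equiv E E'.
  have [Z [G [y GE]]] := Null_splice (ext_vanish_Null (splice E s) AK0).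
  have [G' GG' _] := ext_pushout G y; exists G' => E' G'E'.
  apply: (ext_pushout_equiv (rst_refl _ _ G) GE).
  by rewrite -(comp1m (idm A)); apply: extmor_comp GG' G'E'.
move=> E F; have [GE EP] := from_mid E; have [GF FP] := from_mid F.
have [E' GE' _] := ext_pushout GE (sproj s).
have [F' GF' _] := ext_pushout GF (sproj s).
apply: (rst_trans _ _ _ _ _ (EP _ GE')).
apply: (rst_trans _ _ _ F'); last by apply: rst_sym; apply: FP.
exact: ext_pushout_equiv (AY0 GE GF) GE' GF'.
Qed.

(* If the pushout of r along sincl s lifts to y, then the pullback of r along
   sproj r' \c y is also a pullback of s. *)
Lemma sesmor_of_pushout_lift B K Z Z' (s : ses B K) (r : ses Z K)
    (r' : ses Z (smid s)) (y : hom Z' (smid r')) :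
  sesmor r r' (idm Z) (sincl s) ->
  exists (t : ses Z' K) (c : hom Z' B),
    sesmor t r (sproj r' \c y) (idm K) /\ sesmor t s c (idm K).
Proof.
move=> [m mi pm]; have [t tr] := ses_pullback r (sproj r' \c y).
have [g gi pg] := tr.
have [|l lE] := kernel_lift (ses_ker r') (g := m \c g - y \c sproj t).
  by rewrite compBr !compA pm comp1m pg subrr.
have li : l \c sincl t = sincl s.
  apply: (sincl_monic r'); rewrite compA lE compBl -!compA gi.
  by rewrite (ses_ker t).1 compm0 subr0 compm1 mi.
have [|c cE] := cokernel_desc (ses_coker t) (g := sproj s \c l).
  by rewrite -compA li (ses_ker s).1.
by exists t, c; split=> //; exists l; rewrite ?compm1.
Qed.

(** This is exactness one place further: a class that dies when pushed out along [sincl s] is in the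
    image of splicing with [s]. *)
Lemma ext_vanish_sub n A B K (s : ses B K) :
  ext_vanish n A B -> ext_vanish n.+1 A (smid s) -> ext_vanish n.+1 A K.
Proof.
move=> AB0 AY0.
have from_end (E : ext n.+1 A K) :
    exists G : ext n A B, ext_equiv E (splice G s).
  have [Z [E' [r ->]]] := unsplice E.
  (* Pushing out [E] along [sincl s] changes only its last piece [r]. The result is [Null], so [E']
     receives a morphism from some [G] over a map that lifts through [smid r']. *)
  have [r' rr' _] := @ext_pushout 0 _ _ _ r (sincl s).
  have [Z' [G [y GE']]] := Null_splice (ext_vanish_Null (splice E' r') AY0).
  have [t [c [tr ts]]] := sesmor_of_pushout_lift y rr'.
  have [G' GG' _] := ext_pushout G c; exists G'.
  apply: (rst_trans _ _ _ (splice G t)).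
    by apply: rst_sym; apply: rst_step; apply: extmor_splice GE' tr.
  by apply: rst_step; apply: extmor_splice GG' ts.
move=> E F; have [GE EP] := from_end E; have [GF FP] := from_end F.
apply: (rst_trans _ _ _ _ _ EP).
apply: (rst_trans _ _ _ (splice GF s)); last exact: rst_sym.
exact: ext_equiv_splice (AB0 GE GF).
Qed.

(** * Comparison with the indexed extensions *)

Definition prev_map_over A A' (E F : nat -> C) (a : hom A A')
    (f : forall i, hom (E i) (F i)) (i : nat) :
    hom (prev A E i) (prev A' F i) :=
  if i is j.+1 then f j else a.

(** Arbitrary end maps are needed for induction on the length: a morphism fixing both ends still
    induces an arbitrary map at the right-hand end of the tail. *)
Definition extension_mor n A B A' B' (E : extension n A B)
    (F : extension n A' B') (a : hom A A') (b : hom B B') : Prop :=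
  exists2 f : forall i, hom (mid E i) (mid F i),
    forall i, (i < n)%N -> diff F i \c f i = prev_map_over a f i \c diff E i &
    f n.-1 \c incl E = incl F \c b.

Lemma extension_morE n A B (E F : extension n A B) :
  extension_morphism E F <-> extension_mor E F (idm A) (idm B).
Proof. by split=> [[f [fd fi]]|[f fd fi]]; exists f => //; move: fi; rewrite compm1. Qed.

Lemma extension_mor_comp n A B A' B' A'' B'' (E : extension n A B)
    (F : extension n A' B') (G : extension n A'' B'') a b a' b' :
  extension_mor E F a b -> extension_mor F G a' b' ->
  extension_mor E G (a' \c a) (b' \c b).
Proof.
move=> [f fd fi] [g gd gi]; exists (fun i => g i \c f i).
  move=> i ltin; rewrite compA gd // -compA fd // compA.
  by case: i {ltin}.
by rewrite -compA fi !compA gi.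
Qed.

Definition cons_mid n Z B (M : C) (E : extension n Z B) (i : nat) : C :=
  if i is j.+1 then mid E j else M.

Definition cons_diff n A Z B (s : ses A Z) (E : extension n Z B) (i : nat) :
    hom (cons_mid (smid s) E i) (prev A (cons_mid (smid s) E) i) :=
  match i with
  | 0 => sproj s
  | 1 => sincl s \c diff E 0
  | j.+2 => diff E j.+1
  end.

Lemma cons_diff_exact n A Z B (s : ses A Z) (E : extension n Z B) i :
  (i.+1 < n.+1)%N -> exact (cons_diff s E i.+1) (cons_diff s E i).
Proof.
case: i => [|[|i]] lti /=.
- exact: exact_epic_kernel (@diff_epic _ _ _ _ E) (ses_ker s).
- by apply/exact_comp_monic; [apply: sincl_monic | apply: (@diff_exact _ _ _ _ E 0)].
- exact: (@diff_exact _ _ _ _ E i.+1).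
Qed.

Lemma cons_incl_exact n A Z B (s : ses A Z) (E : extension n.+1 Z B) :
  exact (incl E : hom B (cons_mid (smid s) E n.+1)) (cons_diff s E n.+1).
Proof.
case: n E => [|n] E /=; last exact: (incl_exact E).
by apply/exact_comp_monic; [apply: sincl_monic | apply: (incl_exact E)].
Qed.

Definition cons_extension n A Z B (s : ses A Z) (E : extension n.+1 Z B) :
    extension n.+2 A B :=
  @Extension C n.+2 A B (cons_mid (smid s) E) (cons_diff s E) (incl E)
    (sproj_epic s) (@cons_diff_exact _ _ _ _ s E) (cons_incl_exact s E)
    (@incl_monic _ _ _ _ E).

(** The record asks for a differential at every index; those from 1 on lie beyond the length and are
    filled with 0. *)
Definition single_diff A B (s : ses A B) (i : nat) :
    hom (smid s) (prev A (fun=> smid s) i) :=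
  if i is j.+1 then 0 else sproj s.

Definition single_extension A B (s : ses A B) : extension 1 A B :=
  @Extension C 1 A B (fun=> smid s) (single_diff s) (sincl s)
    (sproj_epic s) (fun i (lt : (i.+1 < 1)%N) => False_ind _ (notF lt))
    (kernel_exact (ses_ker s)) (sincl_monic s).

Fixpoint extension_of_ext n A B : ext n A B -> extension n.+1 A B :=
  match n with
  | 0 => fun E => single_extension E
  | m.+1 => fun E =>
      cons_extension (projT2 E).1 (extension_of_ext (projT2 E).2)
  end.

Lemma single_extension_mor A B A' B' (s : ses A B) (F : extension 1 A' B') a b
    (m : hom (smid s) (mid F 0)) :
  m \c sincl s = incl F \c b -> diff F 0 \c m = a \c sproj s ->
  extension_mor (single_extension s) F a b.
Proof.
move=> mi pm; exists (fun i => if i is j.+1 then 0 else m) => //.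
by case.
Qed.

Lemma extension_mor_single A B A' B' (E : extension 1 A B) (t : ses A' B') a b
    (m : hom (mid E 0) (smid t)) :
  m \c incl E = sincl t \c b -> sproj t \c m = a \c diff E 0 ->
  extension_mor E (single_extension t) a b.
Proof.
move=> mi pm; exists (fun i => if i is j.+1 then 0 else m) => //.
by case.
Qed.

Lemma cons_extension_mor n A Z B A' Z' B' (s : ses A Z) (E : extension n.+1 Z B)
    (t : ses A' Z') (F : extension n.+1 Z' B') a b :
  extension_mor (cons_extension s E) (cons_extension t F) a b <->
  exists2 z, sesmor s t a z & extension_mor E F z b.
Proof.
split=> [[f fd fi]|[z [m mi pm] [f fd fi]]].
  have f0 : sproj t \c f 0 = a \c sproj s := fd 0 isT.
  have f1 : sincl t \c diff F 0 \c f 1 = f 0 \c (sincl s \c diff E 0) := fd 1 isT.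
  (* The map [z] between the kernels is not part of the indexed data and is recovered from [f 0]. *)
  have [|z zE] := kernel_lift (ses_ker t) (g := f 0 \c sincl s).
    by rewrite compA f0 -compA (ses_ker s).1 compm0.
  exists z; first by exists (f 0).
  exists (fun i => f i.+1) => //.
  move=> [|i] lti; last exact: (fd i.+2).
  by apply: (sincl_monic t); rewrite /= !compA f1 zE compA.
exists (fun i => if i is j.+1 as i' return hom (cons_mid _ E i') (cons_mid _ F i')
  then f j else m) => //.
move=> [|[|i]] lti //=; last exact: (fd i.+1).
by rewrite -compA fd //= !compA mi.
Qed.

Lemma extension_of_ext_mor n A B A' B' (E : ext n A B) (F : ext n A' B') a b :
  extension_mor (extension_of_ext E) (extension_of_ext F) a b <-> extmor E F a b.
Proof.
elim: n A A' E F a => [|n IH] A A' E F a /=.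
  split=> [[f fd fi]|[m mi pm]]; first by exists (f 0) => //; apply: (fd 0).
  exact: (@single_extension_mor _ _ _ _ E (single_extension F) _ _ m).
split=> [/cons_extension_mor[z sz /IH Ez]|[z sz /IH Ez]]; first by exists z.
by apply/cons_extension_mor; exists z.
Qed.

Definition tail_diff n A B (E : extension n.+2 A B) Z
    (e : hom (mid E 1) Z) (i : nat) :
    hom (mid E i.+1) (prev Z (fun j => mid E j.+1) i) :=
  if i is j.+1 then diff E j.+2 else e.

(** [diff E 1] factors as an epic [e] onto the kernel of [diff E 0], and the tail starts with [e].
    Morphisms with identity components in both directions replace an equality of dependent
    records. *)
Lemma uncons_extension n A B (E : extension n.+2 A B) :
  exists Z (s : ses A Z) (F : extension n.+1 Z B),
    extension_mor E (cons_extension s F) (idm A) (idm B) /\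
    extension_mor (cons_extension s F) E (idm A) (idm B).
Proof.
have [Z [k kd]] := ab_kernel (diff E 0).
have [e eE ee] := exact_factor (@diff_exact _ _ _ _ E 0 isT) kd.
have mk := kernel_monic kd.
have dx i : (i.+1 < n.+1)%N -> exact (tail_diff e i.+1) (tail_diff e i).
  case: i => [|i] lti; last exact: (@diff_exact _ _ _ _ E i.+2).
  apply/(exact_comp_monic _ _ mk); rewrite -eE.
  exact: (@diff_exact _ _ _ _ E 1).
have ix : exact (incl E : hom B (mid E n.+1)) (tail_diff e n).
  case: n E k e kd eE ee mk {dx} => [|m] E k e kd eE ee mk /=.
    by apply/(exact_comp_monic _ _ mk); rewrite -eE; apply: (incl_exact E).
  exact: (incl_exact E).
pose s : ses A Z := ses_of_epic (@diff_epic _ _ _ _ E) kd.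
pose F : extension n.+1 Z B := @Extension C n.+1 Z B (fun j => mid E j.+1)
  (tail_diff e) (incl E) ee dx ix (@incl_monic _ _ _ _ E).
exists Z, s, F; split.
  exists (fun i => if i is j.+1 as i' return hom (mid E i') (cons_mid (smid s) F i')
    then idm _ else idm _).
    by move=> [|[|i]] lti /=; rewrite comp1m compm1 // eE.
  by rewrite /= comp1m compm1.
exists (fun i => if i is j.+1 as i' return hom (cons_mid (smid s) F i') (mid E i')
  then idm _ else idm _).
  by move=> [|[|i]] lti /=; rewrite comp1m compm1 // eE.
by rewrite /= comp1m compm1.
Qed.

Definition represents n A B (E : ext n A B) (F : extension n.+1 A B) : Prop :=
  extension_mor (extension_of_ext E) F (idm A) (idm B) /\
  extension_mor F (extension_of_ext E) (idm A) (idm B).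

Lemma representable n A B (F : extension n.+1 A B) : exists E, represents E F.
Proof.
elim: n A F => [|n IH] A F.
  have Fk := exact_kernel (@incl_monic _ _ _ _ F) (incl_exact F).
  pose s : ses A B := ses_of_epic (@diff_epic _ _ _ _ F) Fk.
  exists s; split.
    by apply: (@single_extension_mor _ _ _ _ s F _ _ (idm _));
      rewrite comp1m compm1.
  by apply: (@extension_mor_single _ _ _ _ F s _ _ (idm _));
    rewrite comp1m compm1.
have [Z [s [G [FG GF]]]] := uncons_extension F.
have [E [EG GE]] := IH Z G.
exists (consx s E); split.
  rewrite -(comp1m (idm A)) -(comp1m (idm B)); apply: extension_mor_comp GF.
  by apply/cons_extension_mor; exists (idm Z) => //; apply: sesmor_id.
rewrite -(comp1m (idm A)) -(comp1m (idm B)); apply: (extension_mor_comp FG).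
by apply/cons_extension_mor; exists (idm Z) => //; apply: sesmor_id.
Qed.

(** A zigzag of indexed extensions is translated link by link, after choosing a representative of
    each intermediate term. *)
Lemma represents_equiv n A B (E E' : ext n A B) (F F' : extension n.+1 A B) :
  represents E F -> represents E' F' -> extension_equiv F F' -> ext_equiv E E'.
Proof.
have step (G G' : extension n.+1 A B) (H H' : ext n A B) :
    represents H G -> represents H' G' ->
    extension_mor G G' (idm A) (idm B) -> ext_equiv H H'.
  move=> [HG _] [_ GH'] GG'; apply: rst_step; apply/extension_of_ext_mor.
  by have := extension_mor_comp (extension_mor_comp HG GG') GH'; rewrite !comp1m.
move=> EF E'F' FF'; elim: FF' E E' EF E'F' => {F F'}.
- by move=> F F' /extension_morE FF' E E' EF /(step _ _ _ _ EF); apply.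
- move=> F E E' [EF _] [_ FE']; apply: rst_step; apply/extension_of_ext_mor.
  rewrite -(comp1m (idm A)) -(comp1m (idm B)).
  exact: extension_mor_comp EF FE'.
- by move=> F F' _ IH E E' EF E'F'; apply: rst_sym; apply: IH.
move=> F G F' _ IHF _ IHF' E E' EF E'F'; have [H HG] := representable G.
by apply: (rst_trans _ _ _ H); [apply: IHF | apply: IHF'].
Qed.

Lemma Ext_zeroE n A B : Ext_zero n.+1 A B <-> ext_vanish n A B.
Proof.
split=> [AB0 E F | AB0 E F].
  have refl (G : ext n A B) : represents G (extension_of_ext G).
    by split; apply/extension_of_ext_mor; apply: extmor_id.
  exact: represents_equiv (refl E) (refl F) (AB0 _ _).
have lift (G H : ext n A B) : ext_equiv G H ->
    extension_equiv (extension_of_ext G) (extension_of_ext H).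
  elim=> {G H} [G H GH|G|G H _|G H K _ + _].
  - by apply: rst_step; apply/extension_morE/extension_of_ext_mor.
  - exact: rst_refl.
  - exact: rst_sym.
  - exact: rst_trans.
have [E' [E'E EE']] := representable E; have [F' [F'F FF']] := representable F.
apply: (rst_trans _ _ _ (extension_of_ext E')).
  by apply: rst_step; apply/extension_morE.
apply: (rst_trans _ _ _ (extension_of_ext F')); first by apply/lift/AB0.
by apply: rst_step; apply/extension_morE.
Qed.

(** * Closure by quotients *)

Lemma enat_min_le (P : set nat) n :
  enat_le (enat_min P) (Some n) <-> exists2 m, (m <= n)%N & P m.
Proof.
rewrite /enat_min; case: pselect => [exP|nexP] /=; last first.
  by split=> // -[m _ Pm]; case: nexP; exists m; apply/asboolP.
case: ex_minnP => m /asboolP Pm mP; split=> [|[k kn Pk]]; first by exists m.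
by apply: leq_trans kn; apply/mP/asboolP.
Qed.

Lemma pd_class_le (X T : set C) n :
  enat_le (pd_class X T) (Some n) <->
  forall A B, T A -> X B -> forall k, (n < k)%N -> Ext_zero k A B.
Proof.
split=> [/enat_min_le [m mn mP] A B TA XB k nk | AB0].
  have /enat_min_le [l lm lP] : enat_le (pd X A) (Some m) by apply: mP; exists A.
  by apply: lP => //; apply: leq_ltn_trans (leq_trans lm mn) nk.
apply/enat_min_le; exists n => // _ [A TA <-]; apply/enat_min_le.
by exists n => // B XB k nk; apply: AB0.
Qed.

(** Since [X] may distinguish isomorphic objects, any kernel counts as a cycle, whereas in degree 0
    the cycle is the end object itself. *)
Definition cycle n A B (E : extension n A B) (i : nat) (L : C) : Prop :=
  if i is j.+1 then exists k : hom L (mid E j), is_kernel (diff E j) k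
  else L = A.

Lemma cycle_ses n A B (E : extension n A B) i L K :
  (i < n)%N -> cycle E i L -> cycle E i.+1 K ->
  exists s : ses L K, smid s = mid E i.
Proof.
case: i => [|i] lti /= cL [k kd].
  by rewrite cL; exists (ses_of_epic (@diff_epic _ _ _ _ E) kd).
have [l ld] := cL; have [e eE ee] := exact_factor (diff_exact E lti) ld.
have ke : is_kernel e k by apply/(kernel_comp_monic _ _ (kernel_monic ld)); rewrite -eE.
by exists (ses_of_epic ee ke).
Qed.

Lemma closed_by_quotients_of_pd (X T : set C) n :
  enat_le (pd_class X T) (Some n.+1) ->
  closed_by_quotients n.+1 (X `&` right_perp T) X.
Proof.
move=> /pd_class_le TX0 A B E Emid Eker XB; split=> // t Tt.
have cycle_in i : (i <= n.+1)%N -> exists2 L, cycle E i L & X L.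
  case: i => [|i] lti; first by exists B.
  by have [K [k [XK kd]]] := Eker i lti; exists K => //; exists k.
(* Descending induction on [i]: at [i = n.+1] the bound on the dimension applies, each step towards
   [B] lowers the degree by one, and [i = 0] is the claim for [B]. *)
suff vanish j i L : (i + j = n.+1)%N -> cycle E i L -> X L ->
    forall k, (i < k)%N -> Ext_zero k t L.
  by move=> i i1; apply: (vanish n.+1 0 B).
elim: j i L => [|j IH] i L.
  by rewrite addn0 => -> _ XL k; apply: TX0.
rewrite addnS => ijn cL XL [//|k] ik.
have lti : (i < n.+1)%N by rewrite -ijn ltnS leq_addr.
have [K cK XK] := cycle_in i.+1 lti.
have [s sE] := cycle_ses lti cL cK.
apply/Ext_zeroE/(ext_vanish_quotient (s := s)); apply/Ext_zeroE.
  by apply: (IH i.+1).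
by rewrite sE; apply: (Emid i lti).2.
Qed.

Fixpoint ext_in (W X : set C) (n : nat) (A B : C) : ext n A B -> Prop :=
  match n with
  | 0 => fun E => W (smid E)
  | m.+1 => fun E =>
      [/\ W (smid (projT2 E).1), X (projT1 E) & ext_in W X (projT2 E).2]
  end.

Lemma splice_in (W X : set C) n A B K (E : ext n A B) (s : ses B K) :
  ext_in W X E -> X B -> W (smid s) -> ext_in W X (splice E s).
Proof.
move=> EX XB Ws; elim: n A E EX => [|n IH] A E //=.
by move=> [WE XE /IH].
Qed.

Lemma extension_of_ext_in (W X : set C) n A B (E : ext n A B) :
  ext_in W X E -> X B -> forall i, (i < n.+1)%N ->
  W (mid (extension_of_ext E) i) /\
  exists K (k : hom K (mid (extension_of_ext E) i)),
    X K /\ is_kernel (diff (extension_of_ext E) i) k.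
Proof.
move=> + XB; elim: n A E => [|n IH] A E /=.
  by move=> WE [|//] _; split=> //; exists B, (sincl E); split=> //; apply: ses_ker.
move=> [WE XE /IH tailP] [_|[|i] lti].
- by split=> //; exists (projT1 E), (sincl (projT2 E).1); split=> //; apply: ses_ker.
- have [W0 [K [k [XK kd]]]] := tailP 0 lti.
  split=> //; exists K, k; split=> //.
  by apply/kernel_comp_monic => //; apply: sincl_monic.
- exact: (tailP i.+1).
Qed.

(** The cogenerator property is iterated on the cokernels; each new short exact sequence enters at
    the left-hand end, hence by [splice]. *)
Lemma coresolution (W X : set C) n M :
  relative_cogenerator W X -> X M ->
  exists2 A, X A & exists E : ext n A M, ext_in W X E.
Proof.
move=> [WX cogen]; elim: n M => [|n IH] M XM;
    have [N [M' [f [g [WN XM' /ses_of_short_exact [s sE]]]]]] := cogen M XM.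
  by exists M' => //; exists s; rewrite /= sE.
have [A XA [E EX]] := IH M' XM'.
by exists A => //; exists (splice E s); apply: splice_in => //; rewrite sE.
Qed.

(** Each of the [n.+1] middle terms is acyclic for [D], so passing its short exact sequence from
    right to left raises the degree by one. *)
Lemma ext_in_vanish (W X : set C) D n A B (E : ext n A B) m :
  (forall M, W M -> forall k, ext_vanish k D M) ->
  ext_in W X E -> ext_vanish m D A -> ext_vanish (m + n).+1 D B.
Proof.
move=> W0; elim: n A E m => [|n IH] A E m /=.
  by rewrite addn0 => WE DA0; apply: ext_vanish_sub DA0 (W0 _ WE _).
move=> [WE XE EX] DA0; rewrite addnS -addSn; apply: IH EX _.
exact: ext_vanish_sub DA0 (W0 _ WE _).
Qed.

End RelativeDimension.

Theorem proposition2p6 (C : abelian) (X T alpha : set C)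
    (alpha_perp : alpha `<=` right_perp T `&` right_perp X)
    (alpha_cogen : relative_cogenerator alpha X)
    (n : nat) (n_ge1 : (1 <= n)%N) :
  closed_by_quotients n (X `&` right_perp T) X <->
  enat_le (pd_class X T) (Some n).
Proof.
case: n n_ge1 => // n _; split; last exact: closed_by_quotients_of_pd.
move=> closedX; apply/pd_class_le => A M TA XM [//|k] nk.
have [B XB [E EX]] := coresolution n alpha_cogen XM.
have inX := extension_of_ext_in EX XM.
have [_ Bperp] : (X `&` right_perp T) B.
  apply: (closedX _ _ (extension_of_ext E)) => // i lti.
    have [aE _] := inX i lti; split; first exact: alpha_cogen.1.
    exact: (alpha_perp _ aE).1.
  by have [_ ?] := inX i lti.
have alpha0 N : alpha N -> forall j, ext_vanish j A N.
  by move=> /alpha_perp [Nperp _] j; apply/Ext_zeroE; apply: Nperp.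
(* The degree [k.+1] at [M] is reached by [n.+1] shifts from the degree [k - n] at [B], which is
   positive, so [Bperp] applies. *)
apply/Ext_zeroE; rewrite -(@subnK n.+1 k) ?addnS //.
by apply: ext_in_vanish alpha0 EX _; apply/Ext_zeroE; apply: Bperp.
Qed.
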